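(* Let $\Pi$ be a finite simply laced diagram with vertex set labelled by $I=\{1,\dots,n\}$, $n\ge2$, and let $\mathrm{Spin}(\Pi)$, with enveloping homomorphisms $\widetilde\tau_{ij}:\widetilde G_{ij}\to\mathrm{Spin}(\Pi)$, be the universal enveloping group of the standard $\mathrm{Spin}(2)$-amalgam $\{\widetilde G_{ij},\widetilde\phi^i_{ij}\}$ of $\Pi$. For $i\in I$ let $\widehat s_i:=\widetilde\tau_{ij}(\widetilde\phi^i_{ij}(S(\pi/4)))$ (independent of $j\ne i$), an element of order $8$, and $\widehat W:=\langle\widehat s_i\mid i\in I\rangle\le\mathrm{Spin}(\Pi)$. Then $r_i\mapsto\widehat s_i$ extends to an isomorphism from the group $W^{\mathrm{spin}}(\Pi)$ with presentation $\langle r_1,\dots,r_n\mid r_i^8=1;\ r_i^{-1}r_j^2r_i=r_j^2r_i^{2n(i,j)}\ (i\ne j);\ r_ir_jr_i\cdots=r_jr_ir_j\cdots\ (m_{ij}\text{ factors each side},\ i\ne j)\rangle$ onto $\widehat W$, where $m_{ij}=3$, $n(i,j)=1$ if $i,j$ are adjacent and $m_{ij}=2$, $n(i,j)=0$ otherwise.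
   Context: $\mathrm{Spin}(m)$ lives in the Clifford algebra with $e_k^2=-1$, $e_ke_l=-e_le_k$; $S(\alpha)=\cos\alpha+\sin\alpha\,e_1e_2\in\mathrm{Spin}(2)$. Standard $\mathrm{Spin}(2)$-amalgam of simply laced $\Pi$: for $i<j$ adjacent, $\widetilde G_{ij}=\mathrm{Spin}(3)$ with $\widetilde\phi^i_{ij}(a+be_1e_2)=a+be_1e_2$ and $\widetilde\phi^j_{ij}(a+be_1e_2)=a+be_2e_3$; for $i<j$ non-adjacent, $\widetilde G_{ij}=\mathrm{Spin}(2)\times\mathrm{Spin}(2)$ with $\widetilde\phi^i_{ij}(x)=(x,1)$, $\widetilde\phi^j_{ij}(x)=(1,x)$. A universal enveloping group of an amalgam $\{G_{ij},\phi^i_{ij}\}$ is a group $G$ with homomorphisms $\tau_{ij}:G_{ij}\to G$ whose images generate $G$, with $\tau_{ij}\circ\phi^j_{ij}=\tau_{kj}\circ\phi^j_{kj}$ for pairwise distinct $i,j,k$, through which every other such family factors uniquely (e.g. the group generated by all $G_{ij}$ subject to their relations and the identifications $\phi^j_{ij}(x)=\phi^j_{kj}(x)$). *)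

(* Defs.v *)
From Stdlib Require Import Reals Lra Lia List Arith.
Import ListNotations.
Set Implicit Arguments.
Open Scope R_scope.

(* Groups given by presentations: words over an alphabet A, a letter   *)
(* (a, true) is the generator a, (a, false) its formal inverse.        *)
(* pres_eq R is the congruence generated by free reduction and the     *)
(* defining relations R; words modulo pres_eq R = <A | R>.             *)
Inductive pres_eq {A : Type} (Rel : list (A * bool) -> list (A * bool) -> Prop)
  : list (A * bool) -> list (A * bool) -> Prop :=
| pe_refl w : pres_eq Rel w w
| pe_sym w1 w2 : pres_eq Rel w1 w2 -> pres_eq Rel w2 w1
| pe_trans w1 w2 w3 : pres_eq Rel w1 w2 -> pres_eq Rel w2 w3 -> pres_eq Rel w1 w3
| pe_free u v a b : pres_eq Rel (u ++ (a, b) :: (a, negb b) :: v) (u ++ v)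
| pe_rel u v w1 w2 : Rel w1 w2 -> pres_eq Rel (u ++ w1 ++ v) (u ++ w2 ++ v).

(* Spin(2) and Spin(3) inside the Clifford algebra (e_k^2 = -1).       *)
(* Spin(3) = { a + b e1e2 + c e2e3 + d e1e3 : a^2+b^2+c^2+d^2 = 1 },    *)
(* recorded as mkQ a b c d.  Spin(2) = { a + b e1e2 : a^2+b^2 = 1 },    *)
(* recorded as the pair (a, b).  Spin(2) x Spin(2) is recorded as       *)
(* mkQ a b c d  meaning  (a + b e1e2, c + d e1e2).                      *)
Record Q := mkQ { q0 : R; q1 : R; q2 : R; q3 : R }.

(* Product in the even Clifford algebra of R^3, with u = e1e2,
   v = e2e3, w = e1e3: u^2=v^2=w^2=-1, uv=-w, vu=w, uw=v, wu=-v,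
   vw=-u, wv=u (all computed from e_k^2=-1, e_k e_l = - e_l e_k). *)
Definition spin3_mul (x y : Q) : Q :=
  mkQ (q0 x * q0 y - q1 x * q1 y - q2 x * q2 y - q3 x * q3 y)
      (q0 x * q1 y + q1 x * q0 y - q2 x * q3 y + q3 x * q2 y)
      (q0 x * q2 y + q2 x * q0 y + q1 x * q3 y - q3 x * q1 y)
      (q0 x * q3 y + q3 x * q0 y - q1 x * q2 y + q2 x * q1 y).

Definition spin22_mul (x y : Q) : Q :=
  mkQ (q0 x * q0 y - q1 x * q1 y) (q0 x * q1 y + q1 x * q0 y)
      (q2 x * q2 y - q3 x * q3 y) (q2 x * q3 y + q3 x * q2 y).

Definition Gone : Q := mkQ 1 0 0 0.

Definition Gmul (adjacent : bool) : Q -> Q -> Q :=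
  if adjacent then spin3_mul else spin22_mul.

Definition inG (adjacent : bool) (x : Q) : Prop :=
  if adjacent then q0 x * q0 x + q1 x * q1 x + q2 x * q2 x + q3 x * q3 x = 1
  else q0 x * q0 x + q1 x * q1 x = 1 /\ q2 x * q2 x + q3 x * q3 x = 1.

Definition inSpin2 (y : R * R) : Prop := fst y * fst y + snd y * snd y = 1.

(* phi adj i j y = \tilde\phi^i_{ij}(y) in G_{ij} (= G_{ji}), for i <> j.
   The diagram is given by adj (only adj i j with i < j is consulted). *)
Definition phi (adj : nat -> nat -> bool) (i j : nat) (y : R * R) : Q :=
  let a := fst y in let b := snd y in
  let adjacent := adj (Nat.min i j) (Nat.max i j) in
  if Nat.ltb i j then
    (if adjacent then mkQ a b 0 0 else mkQ a b 1 0)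
  else
    (if adjacent then mkQ a 0 b 0 else mkQ 1 0 a b).

Definition S4 : R * R := (cos (PI / 4), sin (PI / 4)).

(* Spin(Pi): universal enveloping group of the standard Spin(2)-       *)
(* amalgam, as the group generated by all G_ij (1<=i<j<=n) subject to  *)
(* their multiplication tables and the identifications                 *)
(* phi^j_ij(y) = phi^j_kj(y) (i,j,k pairwise distinct).                *)
Record Gen (n : nat) (adj : nat -> nat -> bool) := mkGen {
  gi : nat; gj : nat; gx : Q;
  g_valid : (1 <= gi < gj)%nat /\ (gj <= n)%nat /\ inG (adj gi gj) gx }.

Definition inI (n i : nat) : Prop := (1 <= i <= n)%nat.

Inductive spin_rel (n : nat) (adj : nat -> nat -> bool)
  : list (Gen n adj * bool) -> list (Gen n adj * bool) -> Prop :=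
| sr_mul (g h k : Gen n adj) :
    gi h = gi g -> gj h = gj g -> gi k = gi g -> gj k = gj g ->
    gx k = Gmul (adj (gi g) (gj g)) (gx g) (gx h) ->
    spin_rel [(g, true); (h, true)] [(k, true)]
| sr_one (g : Gen n adj) : gx g = Gone -> spin_rel [(g, true)] []
| sr_ident (i j k : nat) (y : R * R) (g h : Gen n adj) :
    inI n i -> inI n j -> inI n k -> i <> j -> j <> k -> i <> k ->
    inSpin2 y ->
    gi g = Nat.min i j -> gj g = Nat.max i j -> gx g = phi adj j i y ->
    gi h = Nat.min k j -> gj h = Nat.max k j -> gx h = phi adj j k y ->
    spin_rel [(g, true)] [(h, true)].
Arguments spin_rel : clear implicits.

Definition Iset (n : nat) := { i : nat | inI n i }.

Definition other (i : nat) : nat := if Nat.eqb i 1 then 2%nat else 1%nat.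

Lemma S4_unit : cos (PI / 4) * cos (PI / 4) + sin (PI / 4) * sin (PI / 4) = 1.
Proof. pose proof (sin2_cos2 (PI / 4)) as H. unfold Rsqr in H. lra. Qed.

Lemma shat_valid (n : nat) (adj : nat -> nat -> bool) (Hn : (2 <= n)%nat)
  (i : nat) (Hi : inI n i) :
  (1 <= Nat.min i (other i) < Nat.max i (other i))%nat /\
  (Nat.max i (other i) <= n)%nat /\
  inG (adj (Nat.min i (other i)) (Nat.max i (other i))) (phi adj i (other i) S4).
Proof.
  unfold inI in Hi.
  assert (Ho : (1 <= other i <= 2)%nat /\ other i <> i).
  { unfold other; destruct (Nat.eqb_spec i 1); lia. }
  split; [lia|]. split; [lia|].
  pose proof S4_unit as HS.
  unfold phi, inG, S4; simpl.
  destruct (Nat.ltb i (other i));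
  destruct (adj (Nat.min i (other i)) (Nat.max i (other i))); simpl;
  try split; lra.
Qed.

Definition shat (n : nat) (adj : nat -> nat -> bool) (Hn : (2 <= n)%nat)
  (i : Iset n) : Gen n adj :=
  @mkGen n adj (Nat.min (proj1_sig i) (other (proj1_sig i)))
    (Nat.max (proj1_sig i) (other (proj1_sig i)))
    (phi adj (proj1_sig i) (other (proj1_sig i)) S4)
    (shat_valid adj Hn (proj2_sig i)).

Fixpoint alt {A : Type} (a b : A) (m : nat) : list A :=
  match m with 0%nat => [] | S m' => a :: alt b a m' end.

Definition n_ij (adj : nat -> nat -> bool) (i j : nat) : nat :=
  if adj (Nat.min i j) (Nat.max i j) then 1%nat else 0%nat.
Definition m_ij (adj : nat -> nat -> bool) (i j : nat) : nat :=
  if adj (Nat.min i j) (Nat.max i j) then 3%nat else 2%nat.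

Inductive W_rel (n : nat) (adj : nat -> nat -> bool)
  : list (Iset n * bool) -> list (Iset n * bool) -> Prop :=
| wr_order (i : Iset n) : W_rel adj (repeat (i, true) 8) []
| wr_sq (i j : Iset n) : proj1_sig i <> proj1_sig j ->
    W_rel adj ((i, false) :: repeat (j, true) 2 ++ [(i, true)])
          (repeat (j, true) 2 ++ repeat (i, true) (2 * n_ij adj (proj1_sig i) (proj1_sig j)))
| wr_braid (i j : Iset n) : proj1_sig i <> proj1_sig j ->
    W_rel adj (map (fun k => (k, true)) (alt i j (m_ij adj (proj1_sig i) (proj1_sig j))))
          (map (fun k => (k, true)) (alt j i (m_ij adj (proj1_sig i) (proj1_sig j)))).
Arguments W_rel : clear implicits.

(* Main.v *)
Require Import Defs.
From Stdlib Require Import Reals Lra Lia List Arith Bool Setoid Morphisms.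
From Stdlib Require Import FunctionalExtensionality Classical ClassicalEpsilon.
Import ListNotations.
Open Scope R_scope.

(* Injectivity is detected by two finite-dimensional representations of Spin(Pi). In the generalized
   spin representation, S(alpha) of the i-th Spin(2) acts as cos(alpha) + sin(alpha) A_i, where
   A_i^2 = -1 and A_i, A_j anticommute if i, j are adjacent and commute otherwise. In the higher spin
   representation on h^* (x) spinors, \hat s_i acts as the simple reflection tensored with its action
   on spinors. Hence a word in the kernel acts trivially on h^*, and since the Weyl group acts
   faithfully there (a reduced word starting with i moves the dominant vector rho across the i-th
   wall), the word is a product of the squares r_i^2. These squares generate a finite group, with
   r_i^2 and r_j^2 commuting up to the central involution r_i^4 = r_j^4 for i, j adjacent, and the
   spin representations restricted to unions of components separate its elements. *)

(** * Quaternion identities for spin 3/2 *)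

Definition qadd (x y : Q) : Q := mkQ (q0 x + q0 y) (q1 x + q1 y) (q2 x + q2 y) (q3 x + q3 y).
Definition qscal (t : R) (x : Q) : Q := mkQ (t * q0 x) (t * q1 x) (t * q2 x) (t * q3 x).
Definition qconj (x : Q) : Q := mkQ (q0 x) (- q1 x) (- q2 x) (- q3 x).
Definition qnorm (x : Q) : R := q0 x * q0 x + q1 x * q1 x + q2 x * q2 x + q3 x * q3 x.
Definition qu : Q := mkQ 0 1 0 0.
Definition qv : Q := mkQ 0 0 1 0.

(* For [a], [b] in the basis [v, w, u] of pure quaternions, the numbers [rot a b x] are the
   entries of the rotation [b |-> x b x^-1] scaled by [qnorm x]. Composing it with the spin representation and conjugating
   by this basis (as in the change of variables [phi^a = Gamma^a psi^a] for the gravitino)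
   yields the matrix with entries [gravitino a b x], all of whose row and column sums are
   [qnorm x * x]. Subtracting that multiple of the identity leaves a combination of the
   [alpha_l alpha_k^T] for the simple roots [e_1 - e_2], [e_2 - e_3] of [A_2]; the coefficients are
   [M11], [M12], [M21], [M22]. *)
Definition rot (a b x : Q) : R :=
  - q0 (spin3_mul (spin3_mul a x) (spin3_mul b (qconj x))).
Definition gravitino (a b x : Q) : Q :=
  qscal (rot a b x) (spin3_mul (spin3_mul a x) (qconj b)).

Definition M11 (x : Q) : Q := qadd (gravitino qv qv x) (qscal (- qnorm x) x).
Definition M12 (x : Q) : Q := qscal (-1) (gravitino qv qu x).
Definition M21 (x : Q) : Q := qscal (-1) (gravitino qu qv x).
Definition M22 (x : Q) : Q := qadd (gravitino qu qu x) (qscal (- qnorm x) x).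

(* [[2, -1], [-1, 2]] is the Cartan matrix of [A_2]; both sides are homogeneous, so that the
   identity holds without assuming [qnorm x = qnorm y = 1]. *)
Definition cocycle (x y Mxy Mx1 Mx2 My1 My2 Mx My : Q) : Prop :=
  Mxy = qadd (qadd (qscal (qnorm y) (spin3_mul Mx y)) (qscal (qnorm x) (spin3_mul x My)))
        (qadd (spin3_mul Mx1 (qadd (qscal 2 My1) (qscal (-1) My2)))
              (spin3_mul Mx2 (qadd (qscal 2 My2) (qscal (-1) My1)))).

Ltac qsolve :=
  intros; repeat match goal with x : Q |- _ => destruct x end;
  cbv [cocycle M11 M12 M21 M22 gravitino rot qu qv qadd qscal qconj qnorm spin3_mul
       q0 q1 q2 q3]; f_equal; ring.

Lemma M11_mul x y :
  cocycle x y (M11 (spin3_mul x y)) (M11 x) (M12 x) (M11 y) (M21 y) (M11 x) (M11 y).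
Proof. qsolve. Qed.
Lemma M12_mul x y :
  cocycle x y (M12 (spin3_mul x y)) (M11 x) (M12 x) (M12 y) (M22 y) (M12 x) (M12 y).
Proof. qsolve. Qed.
Lemma M21_mul x y :
  cocycle x y (M21 (spin3_mul x y)) (M21 x) (M22 x) (M11 y) (M21 y) (M21 x) (M21 y).
Proof. qsolve. Qed.
Lemma M22_mul x y :
  cocycle x y (M22 (spin3_mul x y)) (M21 x) (M22 x) (M12 y) (M22 y) (M22 x) (M22 y).
Proof. qsolve. Qed.

(** * Group presentations *)

#[export] Instance pres_eq_equiv (A : Type) (Rel : list (A * bool) -> list (A * bool) -> Prop) :
  Equivalence (pres_eq Rel).
Proof.
  split; [exact (@pe_refl _ _) | exact (@pe_sym _ _) | exact (@pe_trans _ _)].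
Qed.

Lemma pres_eq_context (A : Type) (Rel : list (A * bool) -> list (A * bool) -> Prop) u v w1 w2 :
  pres_eq Rel w1 w2 -> pres_eq Rel (u ++ w1 ++ v) (u ++ w2 ++ v).
Proof.
  induction 1 as [w|w1 w2 _ IH|w1 w2 w3 _ IH1 _ IH2|u' v' a b|u' v' w1 w2 Hr].
  - reflexivity.
  - symmetry; exact IH.
  - transitivity (u ++ w2 ++ v); assumption.
  - pose proof (pe_free Rel (u ++ u') (v' ++ v) a b) as H.
    repeat rewrite <- app_assoc in *. exact H.
  - pose proof (pe_rel Rel (u ++ u') (v' ++ v) w1 w2 Hr) as H.
    repeat rewrite <- app_assoc in *. exact H.
Qed.

#[export] Instance app_pres_eq (A : Type) (Rel : list (A * bool) -> list (A * bool) -> Prop) :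
  Proper (pres_eq Rel ==> pres_eq Rel ==> pres_eq Rel) (@app (A * bool)).
Proof.
  intros u u' Hu v v' Hv. transitivity (u' ++ v).
  - exact (pres_eq_context _ Rel [] v _ _ Hu).
  - pose proof (pres_eq_context _ Rel u' [] _ _ Hv) as H.
    now rewrite !app_nil_r in H.
Qed.

#[export] Instance cons_pres_eq (A : Type) (Rel : list (A * bool) -> list (A * bool) -> Prop) :
  Proper (eq ==> pres_eq Rel ==> pres_eq Rel) (@cons (A * bool)).
Proof. intros l _ <- v v' Hv. change (pres_eq Rel ([l] ++ v) ([l] ++ v')). now rewrite Hv. Qed.

Lemma pres_eq_of_rel (A : Type) (Rel : list (A * bool) -> list (A * bool) -> Prop) w1 w2 :
  Rel w1 w2 -> pres_eq Rel w1 w2.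
Proof. intros H. pose proof (pe_rel Rel [] [] w1 w2 H) as H'. now rewrite !app_nil_r in H'. Qed.

Definition inv_word {A : Type} (w : list (A * bool)) : list (A * bool) :=
  rev (map (fun l => (fst l, negb (snd l))) w).

Lemma pres_eq_mul_inv (A : Type) (Rel : list (A * bool) -> list (A * bool) -> Prop) w :
  pres_eq Rel (w ++ inv_word w) [].
Proof.
  induction w as [|[a b] w IH]; [reflexivity|].
  unfold inv_word in *; cbn [map rev app fst snd].
  rewrite app_assoc, IH. exact (pe_free Rel [] [] a b).
Qed.

Lemma inv_word_involutive (A : Type) (w : list (A * bool)) : inv_word (inv_word w) = w.
Proof.
  unfold inv_word. rewrite map_rev, rev_involutive, map_map.
  erewrite map_ext; [apply map_id|]. intros [a b]; cbn. now rewrite negb_involutive.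
Qed.

Lemma pres_eq_inv_mul (A : Type) (Rel : list (A * bool) -> list (A * bool) -> Prop) w :
  pres_eq Rel (inv_word w ++ w) [].
Proof. rewrite <- (inv_word_involutive _ w) at 2. apply pres_eq_mul_inv. Qed.

Lemma pres_eq_cancel_l (A : Type) (Rel : list (A * bool) -> list (A * bool) -> Prop) u v w :
  pres_eq Rel (w ++ u) (w ++ v) -> pres_eq Rel u v.
Proof.
  intros H. rewrite <- (app_nil_l u), <- (app_nil_l v), <- (pres_eq_inv_mul _ Rel w).
  rewrite <- !app_assoc. now rewrite H.
Qed.

Lemma pres_eq_cancel_r (A : Type) (Rel : list (A * bool) -> list (A * bool) -> Prop) u v w :
  pres_eq Rel (u ++ w) (v ++ w) -> pres_eq Rel u v.
Proof.
  intros H. rewrite <- (app_nil_r u), <- (app_nil_r v), <- (pres_eq_mul_inv _ Rel w).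
  rewrite !app_assoc. now rewrite H.
Qed.

Lemma pres_eq_div (A : Type) (Rel : list (A * bool) -> list (A * bool) -> Prop) u v :
  pres_eq Rel (u ++ inv_word v) [] <-> pres_eq Rel u v.
Proof.
  split; intros H.
  - apply (pres_eq_cancel_r _ _ _ _ (inv_word v)). now rewrite H, pres_eq_mul_inv.
  - now rewrite H, pres_eq_mul_inv.
Qed.

Definition act_word {A X : Type} (act : A * bool -> X -> X) (w : list (A * bool)) (x : X) : X :=
  fold_right act x w.

Lemma act_word_app (A X : Type) (act : A * bool -> X -> X) u v x :
  act_word act (u ++ v) x = act_word act u (act_word act v x).
Proof. apply fold_right_app. Qed.

(** A form of von Dyck's theorem, phrased for actions on a set so that no target group has to be
    built. *)
Lemma pres_eq_act (A X : Type) (Rel : list (A * bool) -> list (A * bool) -> Prop)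
  (act : A * bool -> X -> X) :
  (forall a b x, act (a, b) (act (a, negb b) x) = x) ->
  (forall w1 w2 x, Rel w1 w2 -> act_word act w1 x = act_word act w2 x) ->
  forall u v, pres_eq Rel u v -> forall x, act_word act u x = act_word act v x.
Proof.
  intros Hinv Hrel u v. induction 1 as [w|w1 w2 _ IH|w1 w2 w3 _ IH1 _ IH2|u v a b|u v w1 w2 Hr];
    intros x; try congruence.
  - rewrite !act_word_app. cbn. now rewrite Hinv.
  - rewrite !act_word_app. now rewrite (Hrel w1 w2).
Qed.

(** * Actions of Spin(Pi) *)

Definition ginv (adjacent : bool) (x : Q) : Q :=
  if adjacent then qconj x else mkQ (q0 x) (- q1 x) (q2 x) (- q3 x).

(* [Gone] is the unit of [Spin(3)] only; in [Spin(2) x Spin(2)] the unit is [mkQ 1 0 1 0]. *)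
Definition gunit (adjacent : bool) : Q := if adjacent then Gone else mkQ 1 0 1 0.

Section SpinAction.
Variables (n : nat) (adj : nat -> nat -> bool) (X : Type).
Variable S : nat -> R -> R -> X -> X.
Variable T : nat -> nat -> Q -> X -> X.

(** Since [S] depends on one index only, the identifications of the amalgam are built in. For
    non-adjacent pairs commutation suffices; for adjacent ones [T] is an action of [Spin(3)]
    extending the two circle actions. *)
Record spin_action : Prop := {
  S_one : forall i x, inI n i -> S i 1 0 x = x;
  S_mul : forall i a b c d x, inI n i -> inSpin2 (a, b) -> inSpin2 (c, d) ->
    S i a b (S i c d x) = S i (a * c - b * d) (a * d + b * c) x;
  S_comm : forall i j a b c d x, inI n i -> inI n j -> i <> j ->
    adj i j = false -> S i a b (S j c d x) = S j c d (S i a b x);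
  T_mul : forall i j p q x, inI n i -> inI n j -> (i < j)%nat -> adj i j = true ->
    inG true p -> inG true q -> T i j p (T i j q x) = T i j (spin3_mul p q) x;
  T_l : forall i j a b x, inI n i -> inI n j -> (i < j)%nat -> adj i j = true ->
    inSpin2 (a, b) -> T i j (mkQ a b 0 0) x = S i a b x;
  T_r : forall i j a b x, inI n i -> inI n j -> (i < j)%nat -> adj i j = true ->
    inSpin2 (a, b) -> T i j (mkQ a 0 b 0) x = S j a b x }.

Hypothesis HST : spin_action.

Definition elt_act (i j : nat) (q : Q) (x : X) : X :=
  if adj i j then T i j q x else S i (q0 q) (q1 q) (S j (q2 q) (q3 q) x).

Definition letter_act (l : Gen n adj * bool) (x : X) : X :=
  let (g, b) := l in
  elt_act (gi g) (gj g) (if b then gx g else ginv (adj (gi g) (gj g)) (gx g)) x.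

Lemma elt_act_mul i j p q x : (1 <= i < j)%nat -> (j <= n)%nat ->
  inG (adj i j) p -> inG (adj i j) q ->
  elt_act i j p (elt_act i j q x) = elt_act i j (Gmul (adj i j) p q) x.
Proof.
  intros Hi Hj Hp Hq. unfold elt_act, Gmul.
  assert (inI n i /\ inI n j) as [Ii Ij] by (unfold inI; lia).
  destruct (adj i j) eqn:E.
  - apply (T_mul HST); auto; lia.
  - destruct p as [p0 p1 p2 p3], q as [r0 r1 r2 r3]; cbn in Hp, Hq |- *.
    rewrite <- (S_comm HST i j r0 r1 p2 p3) by (auto; lia).
    rewrite (S_mul HST j) by (unfold inSpin2; cbn; intuition).
    rewrite (S_mul HST i) by (unfold inSpin2; cbn; intuition).
    repeat f_equal; ring.
Qed.

Lemma elt_act_one i j x : (1 <= i < j)%nat -> (j <= n)%nat ->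
  elt_act i j (gunit (adj i j)) x = x.
Proof.
  intros Hi Hj. unfold elt_act, gunit.
  assert (inI n i /\ inI n j) as [Ii Ij] by (unfold inI; lia).
  destruct (adj i j) eqn:E; cbn.
  - unfold Gone. rewrite (T_l HST) by (auto; try lia; unfold inSpin2; cbn; ring).
    now apply (S_one HST).
  - now rewrite !(S_one HST).
Qed.

Lemma inG_ginv b q : inG b q -> inG b (ginv b q).
Proof. destruct b; cbn; [|intros [H1 H2]; split]; cbn; lra. Qed.

Lemma Gmul_ginv b q : inG b q -> Gmul b q (ginv b q) = gunit b.
Proof.
  destruct q as [a b' c d], b; cbn; unfold Gmul, spin3_mul, spin22_mul, Gone; cbn.
  - intros H; f_equal; lra.
  - intros [H1 H2]; f_equal; lra.
Qed.

Lemma ginv_involutive b q : ginv b (ginv b q) = q.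
Proof. destruct q, b; cbn; unfold qconj; cbn; f_equal; ring. Qed.

Lemma letter_act_inv g b x : letter_act (g, b) (letter_act (g, negb b) x) = x.
Proof.
  cbn [letter_act]. destruct (g_valid g) as [H1 [H2 H3]].
  rewrite elt_act_mul by (destruct b; cbn; auto using inG_ginv).
  rewrite <- (elt_act_one (gi g) (gj g) x) at 2 by auto. f_equal.
  destruct b; cbn [negb].
  - now apply Gmul_ginv.
  - rewrite <- (ginv_involutive (adj (gi g) (gj g)) (gx g)) at 2.
    now apply Gmul_ginv, inG_ginv.
Qed.

Lemma elt_act_phi i j y x : inI n i -> inI n j -> i <> j -> inSpin2 y ->
  elt_act (Nat.min i j) (Nat.max i j) (phi adj i j y) x = S i (fst y) (snd y) x.
Proof.
  intros Hi Hj Hij Hy. unfold elt_act, phi. destruct y as [a b]; cbn [fst snd].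
  destruct (Nat.ltb_spec i j) as [Hlt|Hge].
  - rewrite Nat.min_l, Nat.max_r by lia. destruct (adj i j) eqn:E; cbn.
    + now apply (T_l HST).
    + now rewrite (S_one HST).
  - rewrite Nat.min_r, Nat.max_l by lia. destruct (adj j i) eqn:E; cbn.
    + apply (T_r HST); auto; lia.
    + now rewrite (S_one HST).
Qed.

Lemma ginv_phi i j y :
  ginv (adj (Nat.min i j) (Nat.max i j)) (phi adj i j y) = phi adj i j (fst y, - snd y).
Proof.
  unfold phi; cbn [fst snd].
  destruct (Nat.ltb i j), (adj _ _); cbn; unfold qconj; cbn; f_equal; ring.
Qed.

Theorem spin_act_invariant u v : pres_eq (spin_rel n adj) u v ->
  forall x, act_word letter_act u x = act_word letter_act v x.
Proof.
  apply pres_eq_act; [exact letter_act_inv|].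
  intros w1 w2 x [g h k H1 H2 H3 H4 H5|g H|i j k y g h Hi Hj Hk Hij Hjk Hik Hy H1 H2 H3 H4 H5 H6];
    cbn -[elt_act].
  - destruct (g_valid g) as [V1 [V2 V3]], (g_valid h) as [_ [_ V4]].
    rewrite H1, H2 in *. rewrite elt_act_mul by auto. now rewrite H3, H4, H5.
  - destruct (g_valid g) as [V1 [V2 V3]]. rewrite <- (elt_act_one (gi g) (gj g) x) at 2 by auto.
    (* For non-adjacent indices [Gone] has second factor $0$ and violates [inG], so only [Spin(3)]
       remains. *)
    rewrite H in *. destruct (adj (gi g) (gj g)); [reflexivity|]. cbn in V3. lra.
  - rewrite H1, H2, H3, H4, H5, H6. rewrite (Nat.min_comm i j), (Nat.max_comm i j),
      (Nat.min_comm k j), (Nat.max_comm k j).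
    rewrite !elt_act_phi by auto. reflexivity.
Qed.

Lemma shat_act (Hn : (2 <= n)%nat) (i : Iset n) b x :
  letter_act (shat adj Hn i, b) x =
  S (proj1_sig i) (cos (PI / 4)) (if b then sin (PI / 4) else - sin (PI / 4)) x.
Proof.
  destruct i as [i Hi]. unfold shat. cbn [letter_act gi gj gx proj1_sig].
  assert (other i <> i /\ inI n (other i)) as [H1 H2]
    by (unfold other, inI; destruct (Nat.eqb_spec i 1); lia).
  assert (HS := S4_unit).
  destruct b; [|rewrite ginv_phi]; rewrite elt_act_phi; auto; unfold inSpin2; cbn; lra.
Qed.
End SpinAction.

(** * Spin representations *)

(** A point [p] is read as a vector over $\mathbb F_2$, and [flip i] adds the $i$-th basis vector to
    it. *)
Definition spinor := (nat -> bool) -> R.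

Definition opp_spinor (s : spinor) : spinor := fun p => - s p.

Definition flip (i : nat) (p : nat -> bool) : nat -> bool :=
  fun k => xorb (p k) (Nat.eqb k i).

Fixpoint parity (f p : nat -> bool) (k : nat) : bool :=
  match k with
  | 0%nat => false
  | S k' => xorb (parity f p k') (f (S k') && p (S k'))
  end.

Lemma parity_flip f p j k : (1 <= j)%nat ->
  parity f (flip j p) k = xorb (parity f p k) (Nat.leb j k && f j).
Proof.
  intros Hj. induction k as [|k IH]; cbn [parity].
  - now replace (Nat.leb j 0) with false by (symmetry; apply Nat.leb_gt; lia).
  - rewrite IH. unfold flip.
    destruct (Nat.eqb_spec (S k) j) as [<-|Hne].
    + rewrite Nat.leb_refl. replace (Nat.leb (S k) k) with false by (symmetry; apply Nat.leb_gt; lia).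
      destruct (parity f p k), (f (S k)), (p (S k)); reflexivity.
    + replace (Nat.leb j (S k)) with (Nat.leb j k).
      * destruct (parity f p k), (f (S k)), (p (S k)), (Nat.leb j k), (f j); reflexivity.
      * destruct (Nat.leb_spec j k), (Nat.leb_spec j (S k)); auto; lia.
Qed.

Lemma flip_flip i p : flip i (flip i p) = p.
Proof. extensionality k. unfold flip. now destruct (p k), (Nat.eqb k i). Qed.

Lemma flip_comm i j p : flip i (flip j p) = flip j (flip i p).
Proof. extensionality k. unfold flip. now destruct (p k), (Nat.eqb k i), (Nat.eqb k j). Qed.

Definition sgn (b : bool) : R := if b then -1 else 1.

Section Clifford.
Variables (n : nat) (adj : nat -> nat -> bool).
Hypothesis Hsym : forall i j, adj i j = adj j i.

(** A bilinear form over $\mathbb F_2$ with diagonal $1$, giving $A_i^2=-1$, and with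
    $f(i,j)+f(j,i)=1$ exactly for adjacent $i\ne j$, giving the commutation signs. *)
Definition form (i k : nat) : bool :=
  if Nat.eqb i k then true else if Nat.ltb i k then adj i k else false.

(** The operator $A_i$: translation by the $i$-th basis vector, twisted by the sign $(-1)^{f(i,p)}$,
    as in the regular representation of a twisted group algebra. *)
Definition cliff (i : nat) (s : spinor) : spinor :=
  fun p => sgn (parity (form i) p n) * s (flip i p).

Lemma cliff_neg i s : cliff i (opp_spinor s) = opp_spinor (cliff i s).
Proof. extensionality p. unfold cliff, opp_spinor. ring. Qed.

Lemma cliff_cliff i j s p : inI n i ->
  cliff i (cliff j s) p =
  sgn (parity (form i) p n) * sgn (parity (form j) p n) * sgn (form j i) * s (flip i (flip j p)).
Proof.
  intros [H1 H2]. unfold cliff. rewrite parity_flip by lia. rewrite (flip_comm j i).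
  replace (Nat.leb i n) with true by (symmetry; apply Nat.leb_le; lia).
  destruct (parity (form i) p n), (parity (form j) p n), (form j i); cbn; ring.
Qed.

Lemma cliff_sqr i s : inI n i -> cliff i (cliff i s) = opp_spinor s.
Proof.
  intros Hi. extensionality p. rewrite cliff_cliff by auto. rewrite flip_flip. unfold opp_spinor, form.
  rewrite Nat.eqb_refl. destruct (parity _ p n); cbn; ring.
Qed.

Lemma form_swap i j : i <> j -> xorb (form i j) (form j i) = adj i j.
Proof.
  intros Hij. unfold form. rewrite (Hsym j i).
  destruct (Nat.eqb_spec i j), (Nat.eqb_spec j i), (Nat.ltb_spec i j), (Nat.ltb_spec j i); try lia;
    now destruct (adj i j).
Qed.

Lemma cliff_anticomm i j s : inI n i -> inI n j -> i <> j -> adj i j = true ->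
  cliff i (cliff j s) = opp_spinor (cliff j (cliff i s)).
Proof.
  intros Hi Hj Hij E. extensionality p. unfold opp_spinor. rewrite !cliff_cliff by auto.
  rewrite (flip_comm j i). pose proof (form_swap i j Hij) as H. rewrite E in H.
  destruct (form i j), (form j i); try discriminate; cbn; ring.
Qed.

Lemma cliff_comm i j s : inI n i -> inI n j -> i <> j -> adj i j = false ->
  cliff i (cliff j s) = cliff j (cliff i s).
Proof.
  intros Hi Hj Hij E. extensionality p. rewrite !cliff_cliff by auto.
  rewrite (flip_comm j i). pose proof (form_swap i j Hij) as H. rewrite E in H.
  destruct (form i j), (form j i); try discriminate; cbn; ring.
Qed.

Definition spin2 (i : nat) (a b : R) (s : spinor) : spinor :=
  fun p => a * s p + b * cliff i s p.

(** As $e_1e_2$ and $e_2e_3$ act by $A_i$ and $A_j$, the product $e_1e_3=(e_2e_3)(e_1e_2)$ acts by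
    $A_jA_i$. *)
Definition spin3 (i j : nat) (x : Q) (s : spinor) : spinor :=
  fun p => q0 x * s p + q1 x * cliff i s p + q2 x * cliff j s p + q3 x * cliff j (cliff i s) p.

Lemma cliff_linear k a b c d s1 s2 s3 s4 p :
  cliff k (fun r => a * s1 r + b * s2 r + c * s3 r + d * s4 r) p =
  a * cliff k s1 p + b * cliff k s2 p + c * cliff k s3 p + d * cliff k s4 p.
Proof. unfold cliff. ring. Qed.

Lemma cliff_spin2 k i a b s p :
  cliff k (spin2 i a b s) p = a * cliff k s p + b * cliff k (cliff i s) p.
Proof. unfold spin2. generalize (cliff i s); intros t. unfold cliff. ring. Qed.

Lemma spin2_mul i a b c d s p : inI n i ->
  spin2 i a b (spin2 i c d s) p = spin2 i (a * c - b * d) (a * d + b * c) s p.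
Proof.
  intros Hi. unfold spin2 at 1 3. rewrite cliff_spin2, cliff_sqr by auto. unfold spin2, opp_spinor. ring.
Qed.

Lemma spin2_comm i j a b c d s p : inI n i -> inI n j -> i <> j -> adj i j = false ->
  spin2 i a b (spin2 j c d s) p = spin2 j c d (spin2 i a b s) p.
Proof.
  intros Hi Hj Hij E. unfold spin2 at 1 3. rewrite !cliff_spin2, (cliff_comm i j) by auto.
  unfold spin2. ring.
Qed.

Lemma spin3_spin3 i j x y s p : inI n i -> inI n j -> i <> j -> adj i j = true ->
  spin3 i j x (spin3 i j y s) p = spin3 i j (spin3_mul x y) s p.
Proof.
  intros Hi Hj Hij E.
  assert (H : cliff i (spin3 i j y s) = fun r => (- q1 y) * s r + q0 y * cliff i s r
    + q3 y * cliff j s r + (- q2 y) * cliff j (cliff i s) r).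
  { extensionality r. unfold spin3. rewrite cliff_linear.
    rewrite (cliff_anticomm i j (cliff i s)), (cliff_anticomm i j s), !cliff_sqr, cliff_neg by auto.
    unfold opp_spinor. ring. }
  unfold spin3 at 1. rewrite H, cliff_linear. unfold spin3. rewrite cliff_linear.
  rewrite !cliff_sqr by auto. unfold opp_spinor, spin3_mul; cbn [q0 q1 q2 q3]. ring.
Qed.

Lemma spin2_one i s : spin2 i 1 0 s = s.
Proof. extensionality p. unfold spin2. ring. Qed.

(** With [c] the indicator of a union of components, the circles outside it act trivially; varying
    [c] separates the central involutions of different components. *)
Definition half_spin2 (c : nat -> bool) (i : nat) (a b : R) (s : spinor) : spinor :=
  if c i then spin2 i a b s else s.

Definition half_spin3 (c : nat -> bool) (i j : nat) (x : Q) (s : spinor) : spinor :=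
  if c i then spin3 i j x s else s.

Lemma half_spin_action c : (forall i j, inI n i -> inI n j -> adj i j = true -> c i = c j) ->
  spin_action n adj spinor (half_spin2 c) (half_spin3 c).
Proof.
  intros Hc. split.
  - intros i s Hi. unfold half_spin2. destruct (c i); auto using spin2_one.
  - intros i a b d e s Hi _ _. unfold half_spin2. destruct (c i); [|reflexivity].
    extensionality p. now apply spin2_mul.
  - intros i j a b d e s Hi Hj Hij E. unfold half_spin2. destruct (c i), (c j); try reflexivity.
    extensionality p. now apply spin2_comm.
  - intros i j p q s Hi Hj Hij E _ _. unfold half_spin3. destruct (c i); [|reflexivity].
    extensionality r. apply spin3_spin3; auto; lia.
  - intros i j a b s Hi Hj Hij E _. unfold half_spin3, half_spin2. destruct (c i); [|reflexivity].
    extensionality r. unfold spin3, spin2; cbn. ring.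
  - intros i j a b s Hi Hj Hij E _. unfold half_spin3, half_spin2. rewrite (Hc i j Hi Hj E).
    destruct (c j); [|reflexivity].
    extensionality r. unfold spin3, spin2; cbn. ring.
Qed.

(** * The higher spin representation *)

Definition cartan (i k : nat) : R :=
  if Nat.eqb i k then 2 else if adj i k then -1 else 0.

Lemma cartan_diag i : cartan i i = 2.
Proof. unfold cartan. now rewrite Nat.eqb_refl. Qed.

Lemma cartan_off i j : i <> j -> cartan i j = if adj i j then -1 else 0.
Proof. intros H. unfold cartan. now rewrite (proj2 (Nat.eqb_neq i j) H). Qed.

(* The higher spin representation of Kleinschmidt and Nicolai: [y] lists the coordinates of
   a vector of [h^* (x) spinors] with respect to the fundamental weights, so that [alpha_i] has
   coordinates [cartan i k] and pairing with the coroot of [i] is evaluation at [i]. *)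
Definition rs2 (i : nat) (a b : R) (y : nat -> spinor) : nat -> spinor :=
  fun k p => spin2 i a b (y k) p
    + cartan i k * spin2 i (-2 * a * b * b) (-2 * a * a * b) (y i) p.

Definition rs3 (i j : nat) (x : Q) (y : nat -> spinor) : nat -> spinor :=
  fun k p => spin3 i j x (y k) p
    + cartan i k * (spin3 i j (M11 x) (y i) p + spin3 i j (M12 x) (y j) p)
    + cartan j k * (spin3 i j (M21 x) (y i) p + spin3 i j (M22 x) (y j) p).

Lemma spin2_linear i a b t s1 s2 p :
  spin2 i a b (fun r => s1 r + t * s2 r) p = spin2 i a b s1 p + t * spin2 i a b s2 p.
Proof. unfold spin2, cliff. ring. Qed.

Lemma spin3_linear i j x a b s1 s2 s3 s4 s5 p :
  spin3 i j x (fun r => s1 r + a * (s2 r + s3 r) + b * (s4 r + s5 r)) p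
  = spin3 i j x s1 p + a * (spin3 i j x s2 p + spin3 i j x s3 p)
    + b * (spin3 i j x s4 p + spin3 i j x s5 p).
Proof. unfold spin3, cliff. ring. Qed.

Lemma spin3_qadd i j x y s p : spin3 i j (qadd x y) s p = spin3 i j x s p + spin3 i j y s p.
Proof. unfold spin3, qadd; cbn. ring. Qed.

Lemma spin3_qscal i j t x s p : spin3 i j (qscal t x) s p = t * spin3 i j x s p.
Proof. unfold spin3, qscal; cbn. ring. Qed.

Lemma spin3_mul_qadd x y z : spin3_mul x (qadd y z) = qadd (spin3_mul x y) (spin3_mul x z).
Proof. unfold spin3_mul, qadd; cbn. f_equal; ring. Qed.

Lemma spin3_mul_qscal t x y : spin3_mul x (qscal t y) = qscal t (spin3_mul x y).
Proof. unfold spin3_mul, qscal; cbn. f_equal; ring. Qed.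

(** In a product of two operators $x+\sum_{l,k}\alpha_l\alpha_k^\vee M_{lk}$ the inner coroot meets
    the inner root in a Cartan entry, which is the last summand of [cocycle]. *)
Lemma rs3_mul i j x x' y : inI n i -> inI n j -> i <> j -> adj i j = true ->
  qnorm x = 1 -> qnorm x' = 1 ->
  rs3 i j x (rs3 i j x' y) = rs3 i j (spin3_mul x x') y.
Proof.
  intros Hi Hj Hij E N N'. extensionality k; extensionality p.
  unfold rs3 at 1.
  unfold rs3 at 1 2 3 4 5. rewrite !spin3_linear by auto.
  rewrite !spin3_spin3 by auto. rewrite !cartan_diag.
  rewrite (cartan_off i j), (cartan_off j i), (Hsym j i), E by auto.
  unfold rs3. rewrite M11_mul, M12_mul, M21_mul, M22_mul, N, N'.
  repeat rewrite ?spin3_mul_qadd, ?spin3_mul_qscal, ?spin3_qadd, ?spin3_qscal.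
  ring.
Qed.

(** For $a=\cos\alpha$, $b=\sin\alpha$ the operator [rs2] is $e^{\alpha A_i}$ on the kernel of the
    $i$-th coroot and $e^{-3\alpha A_i}$ on $\alpha_i\otimes$ spinors, hence multiplicative in
    $\alpha$. The adjacent case rests on the quaternion identities. *)
Lemma rs_action : spin_action n adj (nat -> spinor) rs2 rs3.
Proof.
  split.
  - intros i y Hi. extensionality k; extensionality p. unfold rs2, spin2. ring.
  - intros i a b c d y Hi H1 H2. unfold inSpin2 in H1, H2; cbn in H1, H2.
    extensionality k; extensionality p. unfold rs2 at 1.
    unfold rs2 at 1 2. rewrite !spin2_linear, !spin2_mul, cartan_diag by auto.
    unfold rs2, spin2.
    (* The coefficients agree only modulo the two circle equations. *)
    assert (H1' : a * a = 1 - b * b) by lra. assert (H2' : c * c = 1 - d * d) by lra.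
    generalize (cliff i (y k) p), (y k p), (cliff i (y i) p), (y i p), (cartan i k).
    intros. ring [H1' H2'].
  - intros i j a b c d y Hi Hj Hij E. extensionality k; extensionality p.
    unfold rs2 at 1 3.
    unfold rs2 at 1 2 3 4. rewrite !spin2_linear.
    rewrite (cartan_off i j), (cartan_off j i), (Hsym j i), E by auto.
    rewrite !(spin2_comm i j) by auto. ring.
  - intros i j p q y Hi Hj Hij E Hp Hq. apply rs3_mul; auto; lia.
  - intros i j a b y Hi Hj Hij E H. unfold inSpin2 in H; cbn in H.
    extensionality k; extensionality p. unfold rs2, rs3.
    cbv [M11 M12 M21 M22 gravitino rot qu qv qadd qscal qconj qnorm spin3_mul spin3 spin2
       q0 q1 q2 q3].  assert (H1' : a * a = 1 - b * b) by lra. ring [H1'].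
  - intros i j a b y Hi Hj Hij E H. unfold inSpin2 in H; cbn in H.
    extensionality k; extensionality p. unfold rs2, rs3.
    cbv [M11 M12 M21 M22 gravitino rot qu qv qadd qscal qconj qnorm spin3_mul spin3 spin2
       q0 q1 q2 q3].  assert (H1' : a * a = 1 - b * b) by lra. ring [H1'].
Qed.
End Clifford.

(** * Normal forms of words in the spin-extended Weyl group *)

Lemma Iset_eq n (i j : Iset n) : proj1_sig i = proj1_sig j -> i = j.
Proof.
  destruct i as [i [H1 H2]], j as [j [H3 H4]]; cbn; intros <-.
  now rewrite (le_unique _ _ H1 H3), (le_unique _ _ H2 H4).
Qed.

Section SpinExtendedWeyl.
Variables (n : nat) (adj : nat -> nat -> bool).
Hypothesis Hsym : forall i j, adj i j = adj j i.
Local Notation word := (list (Iset n * bool)).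
Local Notation "u == v" := (pres_eq (W_rel n adj) u v) (at level 70).

Definition pos (p : list (Iset n)) : word := map (fun i => (i, true)) p.

Definition squares (d : list (Iset n)) : word := flat_map (fun i => [(i, true); (i, true)]) d.

Lemma squares_app d e : squares (d ++ e) = squares d ++ squares e.
Proof. apply flat_map_app. Qed.

Lemma squares_cons i d : squares (i :: d) = squares [i] ++ squares d.
Proof. reflexivity. Qed.

Definition adjacent (i j : Iset n) : bool := adj (proj1_sig i) (proj1_sig j).

Lemma n_ij_adj i j : n_ij adj i j = if adj i j then 1%nat else 0%nat.
Proof.
  unfold n_ij. destruct (Nat.le_ge_cases i j).
  - now rewrite Nat.min_l, Nat.max_r.
  - rewrite Nat.min_r, Nat.max_l by auto. now rewrite Hsym.
Qed.

Lemma m_ij_adj i j : m_ij adj i j = if adj i j then 3%nat else 2%nat.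
Proof.
  unfold m_ij. destruct (Nat.le_ge_cases i j).
  - now rewrite Nat.min_l, Nat.max_r.
  - rewrite Nat.min_r, Nat.max_l by auto. now rewrite Hsym.
Qed.

Lemma squares_four i : squares [i; i; i; i] == [].
Proof. exact (pres_eq_of_rel _ _ _ _ (wr_order adj i)). Qed.

(** The second defining relation multiplied by $r_i$ on the left; it lets squares travel to the
    right end of a word. *)
Lemma square_gen j i : proj1_sig i <> proj1_sig j ->
  squares [j] ++ [(i, true)] == [(i, true)] ++ squares (j :: if adjacent i j then [i] else []).
Proof.
  intros H. pose proof (pres_eq_of_rel _ _ _ _ (wr_sq adj i j H)) as E.
  rewrite n_ij_adj in E. fold (adjacent i j) in E.
  transitivity ([(i, true)] ++ ((i, false) :: repeat (j, true) 2 ++ [(i, true)])).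
  - symmetry. exact (pe_free _ [] _ i true).
  - rewrite E. destruct (adjacent i j); reflexivity.
Qed.

Lemma squares_gen d i : exists d', squares d ++ [(i, true)] == (i, true) :: squares d'.
Proof.
  induction d as [|j d [d' IH]].
  - now exists [].
  - assert (exists e, squares [j] ++ [(i, true)] == [(i, true)] ++ squares e) as [e He].
    { destruct (Nat.eq_dec (proj1_sig i) (proj1_sig j)) as [Heq|Hne].
      - apply Iset_eq in Heq as <-. now exists [i].
      - eexists. now apply square_gen. }
    exists (e ++ d'). rewrite squares_cons, <- app_assoc, IH.
    change ((i, true) :: squares d') with ([(i, true)] ++ squares d').
    rewrite app_assoc, He, squares_app. reflexivity.
Qed.

Lemma squares_pos d p : exists d', squares d ++ pos p == pos p ++ squares d'.
Proof.
  revert d. induction p as [|i p IH]; intros d.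
  - exists d. cbn. now rewrite app_nil_r.
  - destruct (squares_gen d i) as [d1 H1], (IH d1) as [d2 H2]. exists d2.
    change (pos (i :: p)) with ([(i, true)] ++ pos p).
    rewrite app_assoc, H1. cbn [app]. now rewrite H2.
Qed.

Lemma inv_gen i : [(i, false)] == (i, true) :: squares [i; i; i].
Proof.
  apply (pres_eq_cancel_l _ _ _ _ [(i, true)]).
  transitivity (squares [i; i; i; i]); [|reflexivity].
  rewrite squares_four. exact (pe_free _ [] [] i true).
Qed.

(** Inverse letters are removed by $r_i^{-1}=r_i\,r_i^6$, and the squares so created are pushed to
    the right. *)
Lemma word_normal (w : word) : exists p d, w == pos p ++ squares d.
Proof.
  induction w as [|[i b] w (p & d & IH)].
  - now exists [], [].
  - destruct b.
    + exists (i :: p), d. now rewrite IH.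
    + destruct (squares_pos [i; i; i] p) as [e He]. exists (i :: p), (e ++ d).
      change ((i, false) :: w) with ([(i, false)] ++ w). rewrite inv_gen, IH. cbn [app].
      now rewrite app_assoc, He, squares_app, <- app_assoc.
Qed.

Lemma squares_inverse d : exists e, squares d ++ squares e == [].
Proof.
  induction d as [|i d [e IH]].
  - now exists [].
  - exists (e ++ [i; i; i]).
    rewrite squares_app, squares_cons, <- app_assoc, (app_assoc (squares d)), IH.
    apply squares_four.
Qed.

(** * The Weyl group *)

(** Equality modulo the normal subgroup generated by the squares, where the presentation becomes
    that of the Coxeter group. Positive words suffice there because the generators are
    involutions. *)
Definition weyl_eq (p q : list (Iset n)) : Prop := exists d, pos p == pos q ++ squares d.

Lemma weyl_eq_sym p q : weyl_eq p q -> weyl_eq q p.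
Proof.
  intros [d H]. destruct (squares_inverse d) as [e He]. exists e.
  now rewrite H, <- app_assoc, He, app_nil_r.
Qed.

Lemma weyl_eq_trans p q r : weyl_eq p q -> weyl_eq q r -> weyl_eq p r.
Proof.
  intros [d H] [e H']. exists (e ++ d). now rewrite H, H', squares_app, app_assoc.
Qed.

Lemma weyl_eq_cons i p q : weyl_eq p q -> weyl_eq (i :: p) (i :: q).
Proof. intros [d H]. exists d. cbn. now rewrite H. Qed.

Lemma weyl_eq_refl p : weyl_eq p p.
Proof. exists []. cbn. now rewrite app_nil_r. Qed.

Lemma weyl_eq_cancel i p : weyl_eq (i :: i :: p) p.
Proof. exact (squares_pos [i] p). Qed.

Lemma weyl_eq_braid i j p : i <> j ->
  weyl_eq (alt i j (m_ij adj (proj1_sig i) (proj1_sig j)) ++ p)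
          (alt j i (m_ij adj (proj1_sig i) (proj1_sig j)) ++ p).
Proof.
  intros H. exists []. rewrite app_nil_r. unfold pos. rewrite !map_app.
  rewrite (pres_eq_of_rel _ _ _ _ (wr_braid adj i j ltac:(now intros E%Iset_eq))). reflexivity.
Qed.

Definition refl (i : nat) (x : nat -> R) : nat -> R := fun k => x k - cartan adj i k * x i.

(** The exponent of the letter is ignored because a reflection is its own inverse. *)
Definition refl_act (l : Iset n * bool) : (nat -> R) -> nat -> R := refl (proj1_sig (fst l)).

Lemma refl_refl i x : refl i (refl i x) = x.
Proof. extensionality k. unfold refl. rewrite cartan_diag. ring. Qed.

Lemma refl_act_invariant (u v : word) : u == v -> forall x, act_word refl_act u x = act_word refl_act v x.
Proof.
  apply pres_eq_act.
  - intros a b x. apply refl_refl.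
  - intros w1 w2 x [i|i j H|i j H]; cbn -[alt n_ij m_ij].
    + unfold refl_act; cbn. now rewrite !refl_refl.
    + rewrite n_ij_adj. unfold refl_act; destruct (adj _ _); cbn; now rewrite !refl_refl.
    + rewrite m_ij_adj. extensionality k.
      unfold refl_act; destruct (adj _ _) eqn:E; cbn; unfold refl; rewrite ?cartan_diag,
        (cartan_off adj _ _ H), (cartan_off adj _ _ (not_eq_sym H)), (Hsym (proj1_sig j)), E; ring.
Qed.

(** The sign character, which exists because both sides of every relation have lengths of equal
    parity. *)
Lemma parity_invariant (u v : word) : u == v ->
  forall b, act_word (fun _ => negb) u b = act_word (fun _ => negb) v b.
Proof.
  apply pres_eq_act.
  - intros _ _ b. apply negb_involutive.
  - intros w1 w2 b [i|i j H|i j H]; rewrite ?n_ij_adj, ?m_ij_adj; try destruct (adj _ _);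
      destruct b; reflexivity.
Qed.

Lemma refl_squares d x : act_word refl_act (squares d) x = x.
Proof.
  induction d as [|i d IH]; [reflexivity|].
  rewrite squares_cons, act_word_app, IH. apply refl_refl.
Qed.

Lemma parity_squares d b : act_word (fun _ => negb) (squares d) b = b.
Proof.
  induction d as [|i d IH]; [reflexivity|].
  rewrite squares_cons, act_word_app, IH. apply negb_involutive.
Qed.

Lemma weyl_eq_refl_act p q x : weyl_eq p q ->
  act_word refl_act (pos p) x = act_word refl_act (pos q) x.
Proof. intros [d H]. now rewrite (refl_act_invariant _ _ H), act_word_app, refl_squares. Qed.

Lemma parity_pos p : act_word (fun _ => negb) (pos p) true = Nat.even (length p).
Proof.
  induction p as [|i p IH]; [reflexivity|].
  cbn [length]. rewrite Nat.even_succ, <- Nat.negb_even, <- IH. reflexivity.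
Qed.

Lemma weyl_eq_parity p q : weyl_eq p q -> Nat.even (length p) = Nat.even (length q).
Proof.
  intros [d H]. rewrite <- !parity_pos.
  now rewrite (parity_invariant _ _ H), act_word_app, parity_squares.
Qed.

Definition reduced (p : list (Iset n)) : Prop :=
  forall q, weyl_eq p q -> (length p <= length q)%nat.

Lemma reduced_tail i p : reduced (i :: p) -> reduced p.
Proof. intros H q Hq. apply (weyl_eq_cons i), H in Hq. cbn in Hq. lia. Qed.

Lemma not_reduced p : ~ reduced p -> exists q, weyl_eq p q /\ (length q < length p)%nat.
Proof.
  intros H. apply not_all_ex_not in H as [q H]. apply imply_to_and in H as [H1 H2].
  exists q. split; [assumption|lia].
Qed.

Lemma reduced_exists p : exists q, weyl_eq p q /\ reduced q.
Proof.
  induction p as [p IH] using (induction_ltof1 _ (@length _)). unfold ltof in IH.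
  destruct (classic (reduced p)) as [H|H].
  - exists p. auto using weyl_eq_refl.
  - destruct (not_reduced p H) as (q & H1 & H2), (IH q H2) as (r & H3 & H4).
    exists r. eauto using weyl_eq_trans.
Qed.

(** A shorter expression [t] of [i :: w] gives [i :: t] for [w]. Minimality of [w] leaves two
    possible lengths for [t], and parity excludes that of [w]. *)
Lemma exchange i w : reduced w -> ~ reduced (i :: w) ->
  exists t, weyl_eq w (i :: t) /\ (length w = S (length t)) /\ reduced (i :: t).
Proof.
  intros Hw H. destruct (not_reduced _ H) as (t & H1 & H2). exists t.
  assert (E : weyl_eq w (i :: t)).
  { apply weyl_eq_trans with (i :: i :: w); [apply weyl_eq_sym, weyl_eq_cancel|].
    now apply weyl_eq_cons. }
  pose proof (Hw _ E) as H3. apply weyl_eq_parity in H1.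
  cbn [length] in *. rewrite Nat.even_succ, <- Nat.negb_even in H1.
  assert (L : length w = S (length t)).
  { assert (length t <> length w) by (intros E'; rewrite E' in H1; now destruct (Nat.even _)). lia. }
  repeat split; auto.
  intros q Hq. cbn [length]. rewrite <- L. apply Hw. eauto using weyl_eq_trans.
Qed.

(* Strictly dominant: all simple coroots are positive on it. *)
Definition rho : nat -> R := fun _ => 1.

Lemma refl_diag i x : refl i x i = - x i.
Proof. unfold refl. rewrite cartan_diag. ring. Qed.

(** Induction on the length, inside the rank two subgroup of [i] and the first letter [j] of the
    word: braid moves either reduce the claim to shorter words or would shorten [i :: j :: w]. *)
Lemma reduced_positive w i : reduced (i :: w) -> 0 < act_word refl_act (pos w) rho (proj1_sig i).
Proof.
  revert i. induction w as [w IH] using (induction_ltof1 _ (@length _)); unfold ltof in IH.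
  intros i Hr. destruct w as [|j w]; [cbn; unfold rho; lra|].
  assert (Hij : i <> j).
  { intros <-. apply (Nat.lt_irrefl (length w)).
    pose proof (Hr w (weyl_eq_cancel i w)) as H. cbn in H. lia. }
  assert (Hij' : proj1_sig i <> proj1_sig j) by now intros E%Iset_eq.
  pose proof (weyl_eq_braid i j) as B. rewrite m_ij_adj in B.
  pose proof (reduced_tail _ _ Hr) as Hjw.
  destruct (classic (reduced (i :: w))) as [Hiw|Hiw].
  (* The coordinate of $s_jx$ at $i$ is $x_i+x_j$ or $x_i$, according to adjacency. *)
  - assert (P1 := IH w ltac:(cbn; lia) i Hiw). assert (P2 := IH w ltac:(cbn; lia) j Hjw).
    change (act_word refl_act (pos (j :: w)) rho)
      with (refl (proj1_sig j) (act_word refl_act (pos w) rho)).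
    unfold refl. rewrite cartan_off by auto. destruct (adj (proj1_sig j) _); lra.
  - destruct (exchange i w (reduced_tail _ _ Hjw) Hiw) as (t & E & L & Hit).
    destruct (adj (proj1_sig i) (proj1_sig j)) eqn:Ea.
    (* Otherwise $t=jt'$ and $ijw=ijijt'=jijjt'=jit'$, shorter by two. Given this, the coordinate of
       $s_js_ix$ at $i$ is $x_j$, where $x=t\rho$. *)
    + assert (Hjt : reduced (j :: t)).
      { apply NNPP. intros Hjt. destruct (exchange j t (reduced_tail _ _ Hit) Hjt) as (t' & E' & L' & _).
        assert (H : weyl_eq (i :: j :: w) (j :: i :: t')).
        { apply weyl_eq_trans with (i :: j :: i :: j :: t').
          - do 2 apply weyl_eq_cons. eapply weyl_eq_trans; [exact E|]. now apply weyl_eq_cons.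
          - apply weyl_eq_trans with (j :: i :: j :: j :: t').
            + exact (B (j :: t') Hij).
            + do 2 apply weyl_eq_cons. apply weyl_eq_cancel. }
        apply Hr in H. cbn in H. lia. }
      assert (P := IH t ltac:(cbn; lia) j Hjt).
      apply (weyl_eq_cons j) in E. rewrite (weyl_eq_refl_act _ _ _ E).
      change (act_word refl_act (pos (j :: i :: t)) rho)
        with (refl (proj1_sig j) (refl (proj1_sig i) (act_word refl_act (pos t) rho))).
      unfold refl. rewrite !cartan_diag, (cartan_off adj _ _ Hij'),
        (cartan_off adj _ _ (not_eq_sym Hij')), (Hsym (proj1_sig j)), Ea. lra.
    (* Here $ijw=ijit=jiit=jt$, contradicting reducedness. *)
    + assert (H : weyl_eq (i :: j :: w) (j :: t)).
      { apply weyl_eq_trans with (i :: j :: i :: t); [now do 2 apply weyl_eq_cons|].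
        apply weyl_eq_trans with (j :: i :: i :: t); [exact (B (i :: t) Hij)|].
        apply weyl_eq_cons, weyl_eq_cancel. }
      apply Hr in H. cbn in H. lia.
Qed.

Lemma refl_act_faithful w : (forall x, act_word refl_act w x = x) -> exists d, w == squares d.
Proof.
  intros H. destruct (word_normal w) as (p & d & E), (reduced_exists p) as (q & Hq & Hr).
  (* If the reduced word starts with $i$, it sends $\rho$ to a vector with negative $i$-th
     coordinate, whereas that of $\rho$ is $1$. *)
  assert (q = []) as ->.
  { destruct q as [|i q]; [reflexivity|exfalso].
    pose proof (reduced_positive q i Hr) as P.
    pose proof (H rho) as H1. rewrite (refl_act_invariant _ _ E), act_word_app, refl_squares,
      (weyl_eq_refl_act _ _ _ Hq) in H1.
    change (refl (proj1_sig i) (act_word refl_act (pos q) rho) = rho) in H1.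
    apply (f_equal (fun f => f (proj1_sig i))) in H1. rewrite refl_diag in H1. unfold rho at 2 in H1.
    lra. }
  destruct Hq as [e He]. exists (e ++ d). now rewrite E, He, squares_app.
Qed.

(** * The kernel of the map to the Weyl group *)

Lemma squares_context u v d e : squares d == squares e -> squares (u ++ d ++ v) == squares (u ++ e ++ v).
Proof. intros H. rewrite !squares_app. now rewrite H. Qed.

(** The square $r_j^2$ passes the two letters $r_i$ one after the other; for adjacent indices each
    passage leaves a factor $r_i^2$. *)
Lemma squares_swap i j : i <> j ->
  squares [j; i] == squares ([i; j] ++ if adjacent i j then [i; i] else []).
Proof.
  intros H. assert (H' : proj1_sig i <> proj1_sig j) by now intros E%Iset_eq.
  pose proof (square_gen j i H') as G.
  change (squares [j; i]) with ((squares [j] ++ [(i, true)]) ++ [(i, true)]).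
  rewrite G. destruct (adjacent i j); cbn [app].
  - change ([(i, true)] ++ (squares [j] ++ [(i, true)]) ++ [(i, true); (i, true)]
      == squares [i; j; i; i]).
    now rewrite G.
  - change ([(i, true)] ++ squares [j] ++ [(i, true)] == squares [i; j]). now rewrite G.
Qed.

Definition fourths (e : list (Iset n)) : list (Iset n) := flat_map (fun i => [i; i]) e.

Lemma fourths_app e f : fourths (e ++ f) = fourths e ++ fourths f.
Proof. apply flat_map_app. Qed.

(** Swapping $r_j^2r_i^2$ twice yields the factor $r_j^4r_i^4$, which is therefore trivial; now use
    $r_j^8=1$. *)
Lemma squares_adjacent i j : i <> j -> adjacent i j = true -> squares [i; i] == squares [j; j].
Proof.
  intros H E. pose proof (squares_swap i j H) as H1. pose proof (squares_swap j i (not_eq_sym H)) as H2.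
  assert (E' : adjacent j i = true) by (unfold adjacent; now rewrite Hsym).
  rewrite E in H1. rewrite E' in H2. cbn [app] in H1, H2.
  assert (H3 : squares [j; j; i; i] == []).
  { apply (pres_eq_cancel_l _ _ _ _ (squares [j; i])). rewrite <- squares_app, app_nil_r. cbn [app].
    rewrite (squares_context [] [i; i] _ _ (pe_sym H2) : squares [j; i; j; j; i; i] == _). symmetry. exact H1. }
  rewrite <- (squares_context [j; j] [] _ [] H3 : squares [j; j; j; j; i; i] == squares [j; j]).
  symmetry. exact (squares_context [] [i; i] _ [] (squares_four j)).
Qed.

(** Two swaps of adjacent indices produce $r_i^8=1$. *)
Lemma squares_central i j : squares [j; i; i] == squares [i; i; j].
Proof.
  destruct (classic (i = j)) as [<-|H]; [reflexivity|].
  pose proof (squares_swap i j H) as H1. destruct (adjacent i j); cbn [app] in H1.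
  - rewrite (squares_context [] [i] _ _ H1 : squares [j; i; i] == squares [i; j; i; i; i]).
    rewrite (squares_context [i] [i; i] _ _ H1 : _ == squares [i; i; j; i; i; i; i]).
    exact (squares_context [i; i; j] [] _ [] (squares_four i)).
  - rewrite (squares_context [] [i] _ _ H1 : squares [j; i; i] == squares [i; j; i]).
    exact (squares_context [i] [] _ _ H1).
Qed.

Lemma fourths_comm_gen e j : squares (j :: fourths e) == squares (fourths e ++ [j]).
Proof.
  induction e as [|i e IH]; [reflexivity|].
  rewrite (squares_context [] (fourths e) _ _ (squares_central i j)
    : squares (j :: fourths (i :: e)) == squares (i :: i :: j :: fourths e)).
  pose proof (squares_context [i; i] [] _ _ IH) as H. rewrite !app_nil_r in H. exact H.
Qed.

Lemma fourths_comm e d : squares (d ++ fourths e) == squares (fourths e ++ d).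
Proof.
  induction d as [|j d IH]; [cbn; now rewrite app_nil_r|].
  cbn [app]. rewrite (squares_cons j), IH, <- squares_cons.
  change (j :: fourths e ++ d) with ((j :: fourths e) ++ d).
  now rewrite squares_app, fourths_comm_gen, <- squares_app, <- app_assoc.
Qed.

Lemma squares_swap_fourths i j : exists f, squares [i; j] == squares (fourths f ++ [j; i]).
Proof.
  destruct (classic (j = i)) as [<-|H]; [now exists []|].
  exists (if adjacent j i then [j] else []). rewrite <- fourths_comm.
  rewrite (squares_swap j i H). destruct (adjacent j i); reflexivity.
Qed.

Lemma squares_gather i d : exists e, squares (i :: d ++ [i]) == squares (fourths e ++ d).
Proof.
  induction d as [|j d [e IH]]; [now exists [i]|].
  destruct (squares_swap_fourths i j) as [f Hf]. exists (f ++ e).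
  rewrite (squares_context [] (d ++ [i]) _ _ Hf : squares (i :: (j :: d) ++ [i]) == _).
  pose proof (squares_context (fourths f ++ [j]) [] _ _ IH) as H1.
  pose proof (squares_context (fourths f) d _ _ (fourths_comm e [j])) as H2.
  rewrite fourths_app, !app_nil_r in *. repeat rewrite <- app_assoc in *. cbn [app] in *.
  now rewrite H1.
Qed.

(** Two occurrences of the same square are brought together at the cost of central fourth powers and
    merge into a fourth power themselves. *)
Lemma squares_normal d : exists e d', NoDup d' /\ squares d == squares (fourths e ++ d').
Proof.
  induction d as [|i d (e & d' & N & IH)].
  - exists [], []. split; [constructor|reflexivity].
  - assert (E : squares (i :: d) == squares (fourths e ++ i :: d')).
    { rewrite squares_cons, IH, <- squares_cons.
      change (i :: fourths e ++ d') with ([i] ++ fourths e ++ d').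
      now rewrite app_assoc, squares_app, fourths_comm, <- squares_app, <- app_assoc. }
    destruct (classic (In i d')) as [Hin|Hin].
    + apply in_split in Hin as (d1 & d2 & ->). apply NoDup_remove_1 in N.
      destruct (squares_gather i d1) as [f Hf]. exists (e ++ f), (d1 ++ d2). split; [exact N|].
      rewrite E. pose proof (squares_context (fourths e) d2 _ _ Hf) as H.
      cbn [app] in H. rewrite <- !app_assoc in H. cbn [app] in H.
      now rewrite H, fourths_app, <- app_assoc.
    + exists e, (i :: d'). split; [now constructor|exact E].
Qed.

(** * The homomorphism to Spin(Pi) *)

Hypothesis Hn : (2 <= n)%nat.
Local Notation "u =s= v" := (pres_eq (spin_rel n adj) u v) (at level 70).

Definition spin_word (w : word) : list (Gen n adj * bool) :=
  map (fun l => (shat adj Hn (fst l), snd l)) w.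

Lemma inG_gunit b : inG b (gunit b).
Proof. destruct b; cbn; [|split]; ring. Qed.

Lemma Gmul_gunit b q : Gmul b q (gunit b) = q.
Proof. destruct b, q; unfold Gmul, spin3_mul, spin22_mul; cbn; f_equal; ring. Qed.

Lemma inG_Gmul b p q : inG b p -> inG b q -> inG b (Gmul b p q).
Proof.
  destruct b, p as [a b c d], q as [a' b' c' d']; unfold Gmul, spin3_mul, spin22_mul; cbn.
  - intros H H'. transitivity ((a * a + b * b + c * c + d * d) * (a' * a' + b' * b' + c' * c' + d' * d')).
    + ring.
    + rewrite H, H'. ring.
  - intros [H1 H2] [H1' H2']. split.
    + transitivity ((a * a + b * b) * (a' * a' + b' * b')); [ring|rewrite H1, H1'; ring].
    + transitivity ((c * c + d * d) * (c' * c' + d' * d')); [ring|rewrite H2, H2'; ring].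
Qed.

(** A unit is idempotent, so the multiplication table makes it trivial; this also covers
    [Spin(2) x Spin(2)], whose unit is not [Gone]. *)
Lemma gen_unit (g : Gen n adj) : gx g = gunit (adj (gi g) (gj g)) -> [(g, true)] =s= [].
Proof.
  intros H. apply (pres_eq_cancel_l _ _ _ _ [(g, true)]). cbn [app].
  apply pres_eq_of_rel, sr_mul; auto. rewrite H. symmetry. apply Gmul_gunit.
Qed.

(** The validity proofs of [g] and [h] may differ, but [h] is a legitimate value for the product of
    [g] with a unit. *)
Lemma gen_ext (g h : Gen n adj) : gi g = gi h -> gj g = gj h -> gx g = gx h ->
  [(g, true)] =s= [(h, true)].
Proof.
  intros H1 H2 H3. destruct (g_valid g) as [V1 [V2 V3]].
  pose (e := @mkGen n adj (gi g) (gj g) (gunit _) (conj V1 (conj V2 (inG_gunit _)))).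
  transitivity [(g, true); (e, true)].
  - change [(g, true); (e, true)] with ([(g, true)] ++ [(e, true)]).
    now rewrite (gen_unit e eq_refl).
  - apply pres_eq_of_rel, sr_mul; auto. rewrite <- H3. symmetry. apply Gmul_gunit.
Qed.

(** The word is the image of [q] in $G_{ij}$; relations between words thus become computations with
    four real coordinates. *)
Definition represents (i j : nat) (w : list (Gen n adj * bool)) (q : Q) : Prop :=
  exists k, gi k = i /\ gj k = j /\ gx k = q /\ w =s= [(k, true)].

Lemma represents_eq i j w w' q : represents i j w q -> represents i j w' q -> w =s= w'.
Proof.
  intros (k & H1 & H2 & H3 & H) (k' & H1' & H2' & H3' & H'). rewrite H, H'.
  apply gen_ext; congruence.
Qed.

Lemma represents_app i j w w' q q' : represents i j w q -> represents i j w' q' ->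
  represents i j (w ++ w') (Gmul (adj i j) q q').
Proof.
  intros (k & <- & <- & <- & H) (k' & H1' & H2' & <- & H').
  destruct (g_valid k) as [V1 [V2 V3]], (g_valid k') as [_ [_ V3']]. rewrite H1', H2' in V3'.
  pose (e := @mkGen n adj (gi k) (gj k) (Gmul _ (gx k) (gx k')) (conj V1 (conj V2 (inG_Gmul _ _ _ V3 V3')))).
  exists e. repeat split. rewrite H, H'. apply pres_eq_of_rel, sr_mul; auto.
Qed.

Lemma represents_nil i j : (1 <= i < j)%nat -> (j <= n)%nat -> represents i j [] (gunit (adj i j)).
Proof.
  intros V1 V2. exists (@mkGen n adj i j (gunit _) (conj V1 (conj V2 (inG_gunit _)))).
  repeat split. symmetry. now apply gen_unit.
Qed.

Lemma represents_inv i j g q : represents i j [(g, true)] q ->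
  represents i j [(g, false)] (ginv (adj i j) q).
Proof.
  intros (k & <- & <- & <- & H). destruct (g_valid k) as [V1 [V2 V3]].
  pose (e := @mkGen n adj (gi k) (gj k) (ginv _ (gx k)) (conj V1 (conj V2 (inG_ginv _ _ V3)))).
  exists e. repeat split. apply (pres_eq_cancel_l _ _ _ _ [(g, true)]).
  transitivity (@nil (Gen n adj * bool)); [exact (pe_free _ [] [] g true)|].
  symmetry. rewrite H. pose (u := @mkGen n adj (gi k) (gj k) (gunit _) (conj V1 (conj V2 (inG_gunit _)))).
  transitivity [(u, true)]; [|now apply gen_unit].
  apply pres_eq_of_rel, sr_mul; auto. symmetry. now apply Gmul_ginv.
Qed.

Lemma other_spec i : inI n i -> inI n (other i) /\ other i <> i.
Proof. unfold other, inI. destruct (Nat.eqb_spec i 1); lia. Qed.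

Lemma shat_independent (i : Iset n) (j : nat) (g : Gen n adj) :
  inI n j -> j <> proj1_sig i ->
  gi g = Nat.min (proj1_sig i) j -> gj g = Nat.max (proj1_sig i) j ->
  gx g = phi adj (proj1_sig i) j S4 -> [(g, true)] =s= [(shat adj Hn i, true)].
Proof.
  intros Hj Hij H1 H2 H3. destruct (Nat.eq_dec j (other (proj1_sig i))) as [->|Hne].
  - now apply gen_ext.
  - destruct i as [i Hi]; cbn [proj1_sig] in *. destruct (other_spec i Hi) as [Ho Ho'].
    apply pres_eq_of_rel, (@sr_ident n adj j i (other i) S4); auto.
    + exact S4_unit.
    + now rewrite Nat.min_comm.
    + now rewrite Nat.max_comm.
    + apply Nat.min_comm.
    + apply Nat.max_comm.
Qed.

Definition r4 : R := cos (PI / 4).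

Lemma S4_r4 : S4 = (r4, r4).
Proof. unfold S4, r4. now rewrite cos_PI4, sin_PI4. Qed.

Lemma r4_sqr : r4 * r4 = 1 / 2.
Proof. pose proof S4_unit as H. pose proof S4_r4 as E. injection E as E. rewrite E in H. fold r4 in H. lra. Qed.

Lemma inG_phi i j y : inSpin2 y -> inG (adj (Nat.min i j) (Nat.max i j)) (phi adj i j y).
Proof.
  unfold inSpin2, phi. intros H. destruct (Nat.ltb i j), (adj _ _); cbn; try split; lra.
Qed.

Lemma represents_shat (i : Iset n) j : inI n j -> j <> proj1_sig i ->
  represents (Nat.min (proj1_sig i) j) (Nat.max (proj1_sig i) j) [(shat adj Hn i, true)]
    (phi adj (proj1_sig i) j S4).
Proof.
  intros Hj Hij. destruct i as [i Hi]. cbn [proj1_sig] in *.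
  assert (V : (1 <= Nat.min i j < Nat.max i j)%nat /\ (Nat.max i j <= n)%nat) by (unfold inI in *; lia).
  destruct V as [V1 V2].
  pose (g := @mkGen n adj _ _ _ (conj V1 (conj V2 (inG_phi i j S4 S4_unit)))).
  exists g. repeat split. symmetry. now apply shat_independent with j.
Qed.

Lemma Gmul_phi i j y y' :
  Gmul (adj (Nat.min i j) (Nat.max i j)) (phi adj i j y) (phi adj i j y')
  = phi adj i j (fst y * fst y' - snd y * snd y', fst y * snd y' + snd y * fst y').
Proof.
  unfold phi; destruct (Nat.ltb i j), (adj _ _); unfold Gmul, spin3_mul, spin22_mul; cbn; f_equal; ring.
Qed.

Lemma represents_square (i : Iset n) j : inI n j -> j <> proj1_sig i ->
  represents (Nat.min (proj1_sig i) j) (Nat.max (proj1_sig i) j) (spin_word (squares [i]))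
    (phi adj (proj1_sig i) j (0, 1)).
Proof.
  intros Hj Hij. pose proof (represents_shat i j Hj Hij) as H.
  pose proof (represents_app _ _ _ _ _ _ H H) as H2. rewrite Gmul_phi, S4_r4 in H2. cbn [fst snd] in H2.
  pose proof r4_sqr as E.
  replace (r4 * r4 - r4 * r4) with 0 in H2 by lra. replace (r4 * r4 + r4 * r4) with 1 in H2 by lra.
  exact H2.
Qed.

Lemma shat_order (i : Iset n) : repeat (shat adj Hn i, true) 8 =s= [].
Proof.
  destruct (other_spec _ (proj2_sig i)) as [Ho Ho'].
  pose proof (represents_square i _ Ho Ho') as H.
  pose proof (represents_app _ _ _ _ _ _ H H) as H2. rewrite Gmul_phi in H2.
  pose proof (represents_app _ _ _ _ _ _ H2 H2) as H3. rewrite Gmul_phi in H3. cbn [fst snd] in H3.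
  apply (represents_eq _ _ _ _ _ H3).
  replace (phi _ _ _ _) with (gunit (adj (Nat.min (proj1_sig i) (other (proj1_sig i))) (Nat.max (proj1_sig i) (other (proj1_sig i))))).
  - apply represents_nil; pose proof (proj2_sig i); unfold inI in *; cbn in *; lia.
  - unfold phi; destruct (Nat.ltb _ _), (adj _ _); cbn; unfold Gone; f_equal; ring.
Qed.

Lemma pair_relation (i j : Iset n) : proj1_sig i <> proj1_sig j ->
  let i0 := Nat.min (proj1_sig i) (proj1_sig j) in
  let j0 := Nat.max (proj1_sig i) (proj1_sig j) in
  let p := phi adj (proj1_sig i) (proj1_sig j) in
  let p' := phi adj (proj1_sig j) (proj1_sig i) in
  represents i0 j0 [(shat adj Hn i, true)] (p S4)
  /\ represents i0 j0 [(shat adj Hn i, false)] (p (r4, - r4))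
  /\ represents i0 j0 (spin_word (squares [i])) (p (0, 1))
  /\ represents i0 j0 [(shat adj Hn j, true)] (p' S4)
  /\ represents i0 j0 (spin_word (squares [j])) (p' (0, 1)).
Proof.
  intros H i0 j0 p p'.
  pose proof (represents_shat i _ (proj2_sig j) (not_eq_sym H)) as Ri.
  pose proof (represents_shat j _ (proj2_sig i) H) as Rj.
  pose proof (represents_square i _ (proj2_sig j) (not_eq_sym H)) as Qi.
  pose proof (represents_square j _ (proj2_sig i) H) as Qj.
  rewrite Nat.min_comm, Nat.max_comm in Rj, Qj.
  pose proof (represents_inv _ _ _ _ Ri) as Ri'. rewrite ginv_phi, S4_r4 in Ri'.
  repeat split; assumption.
Qed.

Ltac phi_cases A H :=
  match type of H with ?i <> ?j =>
    rewrite ?S4_r4; unfold phi; rewrite ?(Nat.min_comm j i), ?(Nat.max_comm j i), A;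
    destruct (Nat.ltb_spec i j), (Nat.ltb_spec j i); try (exfalso; lia);
    unfold Gmul, spin3_mul, spin22_mul; cbn; f_equal
  end.

Lemma represents_cast i j w q q' : represents i j w q -> q' = q -> represents i j w q'.
Proof. now intros H ->. Qed.

Lemma spin_word_rel w1 w2 : W_rel n adj w1 w2 -> spin_word w1 =s= spin_word w2.
Proof.
  intros [i|i j H|i j H].
  - apply shat_order.
  - destruct (pair_relation i j H) as (Ri & Ri' & Qi & Rj & Qj).
    pose proof (represents_app _ _ _ _ _ _ Ri' (represents_app _ _ _ _ _ _ Qj Ri)) as L.
    pose proof (represents_app _ _ _ _ _ _ Qj Qi) as R. pose proof r4_sqr as E.
    unfold n_ij. destruct (adj (Nat.min _ _) (Nat.max _ _)) eqn:A;
      [refine (represents_eq _ _ _ _ _ L (represents_cast _ _ _ _ _ R _))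
      |refine (represents_eq _ _ _ _ _ L (represents_cast _ _ _ _ _ Qj _))];
      clear - E A H; phi_cases A H; lra.
  - destruct (pair_relation i j H) as (Ri & _ & _ & Rj & _).
    pose proof (represents_app _ _ _ _ _ _ Ri Rj) as R1.
    pose proof (represents_app _ _ _ _ _ _ Rj Ri) as R2.
    pose proof (represents_app _ _ _ _ _ _ R1 Ri) as R3.
    pose proof (represents_app _ _ _ _ _ _ R2 Rj) as R4.
    unfold m_ij. destruct (adj (Nat.min _ _) (Nat.max _ _)) eqn:A;
      [refine (represents_eq _ _ _ _ _ R3 (represents_cast _ _ _ _ _ R4 _))
      |refine (represents_eq _ _ _ _ _ R1 (represents_cast _ _ _ _ _ R2 _))];
      clear - A H; phi_cases A H; ring.
Qed.

Lemma spin_word_eq u v : u == v -> spin_word u =s= spin_word v.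
Proof.
  induction 1 as [w|w1 w2 _ IH|w1 w2 w3 _ IH1 _ IH2|u v a b|u v w1 w2 Hr].
  - reflexivity.
  - symmetry; exact IH.
  - etransitivity; eassumption.
  - unfold spin_word. rewrite !map_app. exact (pe_free _ _ _ _ _).
  - unfold spin_word in *. rewrite !map_app. fold (spin_word w1) (spin_word w2).
    now rewrite (spin_word_rel _ _ Hr).
Qed.

Definition half_act (c : nat -> bool) (w : word) (s : spinor) : spinor :=
  act_word (letter_act n adj spinor (half_spin2 n adj c) (half_spin3 n adj c)) (spin_word w) s.

Definition closed (c : nat -> bool) : Prop :=
  forall i j, inI n i -> inI n j -> adj i j = true -> c i = c j.

Lemma half_act_app c u v s : half_act c (u ++ v) s = half_act c u (half_act c v s).
Proof. unfold half_act, spin_word. rewrite map_app. apply act_word_app. Qed.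

Lemma half_act_gen c i b s : closed c -> half_act c [(i, b)] s =
  half_spin2 n adj c (proj1_sig i) r4 (if b then r4 else - r4) s.
Proof.
  intros Hc. pose proof S4_r4 as E. injection E as E.
  unfold half_act, spin_word. cbn [map fst snd act_word fold_right].
  rewrite (shat_act _ _ _ _ _ (half_spin_action n adj Hsym c Hc)). now rewrite E.
Qed.

Lemma half_act_square c i s : closed c ->
  half_act c (squares [i]) s = if c (proj1_sig i) then cliff n adj (proj1_sig i) s else s.
Proof.
  intros Hc. change (squares [i]) with ([(i, true)] ++ [(i, true)]).
  rewrite half_act_app, !half_act_gen by auto. unfold half_spin2.
  destruct (c (proj1_sig i)); [|reflexivity].
  extensionality p. rewrite spin2_mul by apply (proj2_sig i). pose proof r4_sqr as E.
  unfold spin2. replace (r4 * r4 - r4 * r4) with 0 by lra. replace (r4 * r4 + r4 * r4) with 1 by lra. ring.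
Qed.

Lemma half_act_fourth c i s : closed c ->
  half_act c (squares [i; i]) s = if c (proj1_sig i) then opp_spinor s else s.
Proof.
  intros Hc. change (squares [i; i]) with (squares [i] ++ squares [i]).
  rewrite half_act_app, !half_act_square by auto.
  destruct (c (proj1_sig i)); [|reflexivity]. apply cliff_sqr, (proj2_sig i).
Qed.

Lemma half_act_trivial c w s : closed c -> spin_word w =s= [] -> half_act c w s = s.
Proof.
  intros Hc H.
  exact (spin_act_invariant n adj _ _ _ (half_spin_action n adj Hsym c Hc) _ _ H s).
Qed.

Lemma shat_order_gt i : ~ repeat (shat adj Hn i, true) 4 =s= [].
Proof.
  intros H. pose (c := fun _ : nat => true). assert (Hc : closed c) by now intros ? ? ? ? ?.
  pose proof (half_act_trivial c (squares [i; i]) (fun _ => 1) Hc H) as E.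
  rewrite half_act_fourth in E by auto.
  apply (f_equal (fun f => f (fun _ => false))) in E. unfold opp_spinor in E; cbn in E. lra.
Qed.

(* A central involution [r_i^4] is detected by the spin representation supported on the set of all
   [k] with [r_k^4 = r_i^4], a union of components of the diagram. *)
Lemma fourths_trivial e : spin_word (squares (fourths e)) =s= [] -> squares (fourths e) == [].
Proof.
  induction e as [e IH] using (induction_ltof1 _ (@length _)); unfold ltof in IH. intros H.
  destruct e as [|i e]; [reflexivity|].
  destruct (classic (exists j, In j e /\ squares [j; j] == squares [i; i])) as [(j & Hj & Hji)|Hno].
  - apply in_split in Hj as (e1 & e2 & ->).
    assert (E : squares (fourths (i :: e1 ++ j :: e2)) == squares (fourths (e1 ++ e2))).
    { pose proof (squares_context [] (fourths (j :: e2)) _ _ (fourths_comm e1 [i; i])) as H1.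
      pose proof (squares_context (fourths e1 ++ [i; i]) (fourths e2) _ _ Hji) as H2.
      pose proof (squares_context (fourths e1) (fourths e2) _ [] (squares_four i)) as H3.
      change (fourths (i :: e1 ++ j :: e2)) with ([i; i] ++ fourths (e1 ++ j :: e2)).
      rewrite !fourths_app. repeat rewrite <- app_assoc in *. cbn [app fourths flat_map] in *.
      fold (fourths e1) (fourths e2) in *.
      now rewrite H1, H2, H3. }
    rewrite E. apply IH.
    + cbn. rewrite !length_app. cbn. lia.
    + now rewrite <- (spin_word_eq _ _ E).
  - exfalso.
    pose (P := fun k => exists j, proj1_sig j = k /\ squares [j; j] == squares [i; i]).
    pose (c := fun k => if excluded_middle_informative (P k) then true else false).
    assert (HP : forall k l, inI n l -> adj k l = true -> P k -> P l).
    { intros k l Hl Hkl (j & <- & Hj). exists (exist _ l Hl). split; [reflexivity|].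
      rewrite <- Hj. destruct (classic (exist _ l Hl = j)) as [->|Hne]; [reflexivity|].
      apply squares_adjacent; [exact Hne|]. unfold adjacent; cbn. now rewrite Hsym. }
    assert (Hc : closed c).
    { intros k l Hk Hl Hkl. unfold c. pose proof (HP k l Hl Hkl).
      pose proof (HP l k Hk ltac:(now rewrite Hsym)).
      destruct (excluded_middle_informative (P k)), (excluded_middle_informative (P l)); tauto. }
    assert (Hci : c (proj1_sig i) = true).
    { unfold c. destruct (excluded_middle_informative _) as [_|N]; [reflexivity|].
      destruct N. now exists i. }
    assert (He : forall s, half_act c (squares (fourths e)) s = s).
    { clear - Hsym Hc Hno. intros s. induction e as [|j e IH]; [reflexivity|].
      change (squares (fourths (j :: e))) with (squares [j; j] ++ squares (fourths e)).
      rewrite half_act_app, IH, half_act_fourth by (auto; intros (k & H1 & H2); apply Hno; exists k; cbn; auto).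
      unfold c. destruct (excluded_middle_informative _) as [(k & H1%Iset_eq & H2)|_]; [|reflexivity].
      subst k. destruct Hno. exists j; cbn; auto. }
    pose proof (half_act_trivial c _ (fun _ => 1) Hc H) as E.
    change (squares (fourths (i :: e))) with (squares [i; i] ++ squares (fourths e)) in E.
    rewrite half_act_app, He, half_act_fourth, Hci in E by auto.
    apply (f_equal (fun f => f (fun _ => false))) in E. unfold opp_spinor in E; cbn in E. lra.
Qed.

Definition flips (d : list (Iset n)) (p : nat -> bool) : nat -> bool :=
  fold_left (fun q i => flip (proj1_sig i) q) d p.

Lemma half_act_flips d s p : Rabs (half_act (fun _ => true) (squares d) s p) = Rabs (s (flips d p)).
Proof.
  revert p. induction d as [|i d IH]; intros p; [reflexivity|].
  rewrite squares_cons, half_act_app, half_act_square by now intros ? ? ? ? ?.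
  unfold cliff. rewrite Rabs_mult, IH. unfold sgn.
  destruct (parity _ _ _); [replace (Rabs (-1)) with 1 by (rewrite Rabs_left; lra)|rewrite Rabs_R1];
    apply Rmult_1_l.
Qed.

Lemma flips_fourths e d p : flips (fourths e ++ d) p = flips d p.
Proof. induction e as [|i e IH]; [reflexivity|]. cbn. now rewrite flip_flip. Qed.

Lemma flips_notin i d p : ~ In i d -> flips d p (proj1_sig i) = p (proj1_sig i).
Proof.
  revert p. induction d as [|j d IH]; intros p H; [reflexivity|].
  cbn. unfold flips in IH. rewrite IH by (cbn in H; tauto). unfold flip.
  destruct (Nat.eqb_spec (proj1_sig i) (proj1_sig j)) as [E|_].
  - apply Iset_eq in E. cbn in H. intuition congruence.
  - now destruct (p _).
Qed.

Lemma squares_trivial d : spin_word (squares d) =s= [] -> squares d == [].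
Proof.
  intros H. destruct (squares_normal d) as (e & d' & N & E).
  destruct d' as [|i d'].
  - rewrite app_nil_r in E. rewrite E. apply fourths_trivial. now rewrite <- (spin_word_eq _ _ E).
  - exfalso. rewrite (spin_word_eq _ _ E) in H.
    pose (s := fun p : nat -> bool => if p (proj1_sig i) then 1 else 0).
    pose proof (half_act_flips (fourths e ++ i :: d') s (fun _ => false)) as A.
    rewrite half_act_trivial, flips_fourths in A; [|now intros ? ? ? ? ?|exact H].
    change (flips (i :: d')) with (fun p => flips d' (flip (proj1_sig i) p)) in A.
    unfold s in A. rewrite flips_notin in A by (now inversion N).
    unfold flip in A. rewrite Nat.eqb_refl in A. cbn in A.
    rewrite Rabs_R0, Rabs_R1 in A. lra.
Qed.

Definition tensor (x : nat -> R) (s : spinor) : nat -> spinor := fun k p => x k * s p.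

Lemma rs_tensor w x s :
  act_word (letter_act n adj _ (rs2 n adj) (rs3 n adj)) (spin_word w) (tensor x s)
  = tensor (act_word refl_act w x) (half_act (fun _ => true) w s).
Proof.
  induction w as [|[i b] w IH]; [reflexivity|].
  change (spin_word ((i, b) :: w)) with ([(shat adj Hn i, b)] ++ spin_word w).
  change ((i, b) :: w) with ([(i, b)] ++ w).
  rewrite act_word_app, IH, half_act_app, act_word_app.
  rewrite (half_act_gen (fun _ => true)) by now intros ? ? ? ? ?.
  generalize (half_act (fun _ => true) w s), (act_word refl_act w x). intros t y.
  cbn [act_word fold_right].
  rewrite (shat_act _ _ _ _ _ (rs_action n adj Hsym)). fold r4.
  pose proof S4_r4 as E. injection E as E. rewrite E.
  pose proof r4_sqr as E2.
  extensionality k; extensionality p. unfold rs2, half_spin2, tensor, refl_act, refl, spin2, cliff.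
  cbn [fst]. destruct b.
  - assert (E3 : -2 * r4 * r4 * r4 = - r4).
    { transitivity (-2 * (r4 * r4) * r4); [ring|rewrite E2; field]. }
    rewrite E3. ring.
  - assert (E3 : -2 * r4 * - r4 * - r4 = - r4).
    { transitivity (-2 * (r4 * r4) * r4); [ring|rewrite E2; field]. }
    assert (E4 : -2 * r4 * r4 * - r4 = r4).
    { transitivity (2 * (r4 * r4) * r4); [ring|rewrite E2; field]. }
    rewrite E3, E4. ring.
Qed.

Lemma spin_word_faithful w : spin_word w =s= [] -> w == [].
Proof.
  intros H.
  assert (Hr : forall x, act_word refl_act w x = x).
  { intros x. pose proof (rs_tensor w x (fun _ => 1)) as E.
    rewrite half_act_trivial in E by (auto; now intros ? ? ? ? ?).
    rewrite (spin_act_invariant n adj _ _ _ (rs_action n adj Hsym) _ _ H) in E.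
    extensionality k. apply (f_equal (fun f => f k (fun _ => false))) in E.
    unfold tensor in E. cbn in E. lra. }
  destruct (refl_act_faithful w Hr) as [d Hd]. rewrite Hd.
  apply squares_trivial. now rewrite <- (spin_word_eq _ _ Hd).
Qed.

Lemma spin_word_inv w : spin_word (inv_word w) = inv_word (spin_word w).
Proof. unfold spin_word, inv_word. now rewrite map_rev, !map_map. Qed.

Lemma spin_word_eq_iff u v : u == v <-> spin_word u =s= spin_word v.
Proof.
  split; [apply spin_word_eq|]. intros H. apply pres_eq_div, spin_word_faithful.
  unfold spin_word at 1. rewrite map_app. fold (spin_word u) (spin_word (inv_word v)).
  rewrite spin_word_inv, H. apply pres_eq_mul_inv.
Qed.
End SpinExtendedWeyl.

Theorem theorem2 (n : nat) (adj : nat -> nat -> bool) (Hn : (2 <= n)%nat)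
  (Hsym : forall i j, adj i j = adj j i) (Hirr : forall i, adj i i = false) :

  (forall (i : Iset n) (j : nat) (g : Gen n adj),
      inI n j -> j <> proj1_sig i ->
      gi g = Nat.min (proj1_sig i) j -> gj g = Nat.max (proj1_sig i) j ->
      gx g = phi adj (proj1_sig i) j S4 ->
      pres_eq (spin_rel n adj) [(g, true)] [(shat adj Hn i, true)]) /\

  (forall i : Iset n,
      pres_eq (spin_rel n adj) (repeat (shat adj Hn i, true) 8) [] /\
      ~ pres_eq (spin_rel n adj) (repeat (shat adj Hn i, true) 4) []) /\


  (forall u v : list (Iset n * bool),
      pres_eq (W_rel n adj) u v <->
      pres_eq (spin_rel n adj) (map (fun l => (shat adj Hn (fst l), snd l)) u)
                               (map (fun l => (shat adj Hn (fst l), snd l)) v)).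
Proof.
  split; [|split].
  - intros i j g Hj Hij H1 H2 H3. exact (shat_independent n adj Hn i j g Hj Hij H1 H2 H3).
  - intros i. split; [apply shat_order|now apply shat_order_gt].
  - intros u v. now apply spin_word_eq_iff.
Qed.
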